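(* Let $m=m(n)$ be a sequence of positive integers and $p=p(n)$ satisfy $p=o\!\left(\frac{1}{n\sqrt[3]{m}}\right)$. Put $$\hat p=1-\exp\!\left(-mp^{2}(1-p)^{n-2}\right).$$ Let $a\in[0,1]$ and let $\mathcal A$ be any graph property (an isomorphism-closed family of graphs on the $n$-element vertex set). Then $\Pr\{G(n,\hat p)\in\mathcal A\}\to a$ if and only if $\Pr\{\mathcal G(n,m,p)\in\mathcal A\}\to a$ (limits as $n\to\infty$).
   Context: $G(n,p)$ denotes the binomial random graph on an $n$-element vertex set in which each edge appears independently with probability $p$. The random intersection graph $\mathcal G(n,m,p)$ is defined as follows: there is a vertex set $\mathcal V$ with $|\mathcal V|=n$ and an auxiliary set of objects $\mathcal W$ with $|\mathcal W|=m$; each vertex $v$ is assigned a random set $W(v)\subseteq\mathcal W$, where the events $w\in W(v)$ occur independently with probability $p$ for all pairs $(v,w)\in\mathcal V\times\mathcal W$; two distinct vertices $v_1,v_2$ are adjacent iff $W(v_1)\cap W(v_2)\neq\emptyset$. *)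

(* Defs.v *)
From HB Require Import structures.
From Stdlib Require Import Reals.
From mathcomp Require Import all_boot all_fingroup.
Set Implicit Arguments. Unset Strict Implicit. Unset Printing Implicit Defensive.

HB.instance Definition _ := Monoid.isComLaw.Build R R0 Rplus (fun x y z => esym (Rplus_assoc x y z)) Rplus_comm Rplus_0_l.

Definition Rsum (T : finType) (F : T -> R) : R := \big[Rplus/R0]_(x : T) F x.

Definition graph_property := forall n : nat, rel 'I_n -> bool.

Definition iso_closed (A : graph_property) : Prop :=
  forall (n : nat) (s : {perm 'I_n}) (g : rel 'I_n),
    A n g = A n (fun i j => g (s i) (s j)).

(* potential edges: pairs (i,j) with i < j *)
Definition pairsLt (n : nat) : {set 'I_n * 'I_n} := [set ij : 'I_n * 'I_n | (nat_of_ord ij.1 < nat_of_ord ij.2)%N].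

Definition graph_of_edges (n : nat) (E : {set 'I_n * 'I_n}) : rel 'I_n :=
  fun i j => (i != j) && (((i, j) \in E) || ((j, i) \in E)).

Definition prob_Gnp (n : nat) (p : R) (A : graph_property) : R :=
  Rsum (fun E : {set 'I_n * 'I_n} =>
    if (E \subset pairsLt n) && A n (graph_of_edges E)
    then Rmult (pow p #|E|) (pow (Rminus R1 p) (#|pairsLt n| - #|E|))
    else R0).

(* outcome: incidence set B of pairs (v,w) with w \in W(v) *)
Definition graph_of_incidence (n m : nat) (B : {set 'I_n * 'I_m}) : rel 'I_n :=
  fun i j => (i != j) && [exists w : 'I_m, ((i, w) \in B) && ((j, w) \in B)].

Definition prob_RIG (n m : nat) (p : R) (A : graph_property) : R :=
  Rsum (fun B : {set 'I_n * 'I_m} =>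
    if A n (graph_of_incidence B)
    then Rmult (pow p #|B|) (pow (Rminus R1 p) (n * m - #|B|))
    else R0).

Definition phat (n m : nat) (p : R) : R :=
  Rminus R1 (exp (Ropp (Rmult (Rmult (INR m) (pow p 2)) (pow (Rminus R1 p) (n - 2))))).

(* Main.v *)
(** Object by object, the edge set of the intersection graph is a union of [m]
    independent copies of a random clique, the clique on the set of vertices
    that own the object.  Likewise, since [1 - phat = exp (- q) ^ m] with
    [q = p^2 (1 - p)^(n-2)], the edge set of G(n, phat) is a union of [m]
    independent copies of G(n, r), [r = 1 - exp (- q)].  Hence the two
    probabilities differ by at most [m] times the l1 distance between the laws
    of one copy.  Both laws charge each single edge with [q] up to [O(n^2 q^2)],
    and a random clique has three or more vertices with probability at most
    [C(n, 3) p^3], so that the distance is [O((np)^4 + (np)^3)]; multiplied by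
    [m] this tends to 0. *)
Require Import Defs.
From HB Require Import structures.
From Stdlib Require Import Reals.
From mathcomp Require Import all_boot all_fingroup.
From mathcomp Require Import all_order all_algebra ring lra Rstruct.
Set Implicit Arguments. Unset Strict Implicit. Unset Printing Implicit Defensive.
Import Order.TTheory GRing.Theory Num.Theory.
Local Open Scope ring_scope.

(** * Product measures and the l1 distance *)

Lemma sum_preim (K : zmodType) (S S' : finType) (h : S -> S') (mu : S -> K)
    (P : pred S') :
  \sum_(s' | P s') \sum_(s | h s == s') mu s = \sum_(s | P (h s)) mu s.
Proof.
rewrite (partition_big h P) //=; apply: eq_bigr => s' Ps'.
by apply: eq_bigl => s; case: eqP => [->|]; rewrite ?Ps' ?andbF.
Qed.

(** The fibre over [g] is a product of fibres of [h], so its mass factors: a coordinatewise map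
    carries a product law to the product of the image laws. *)
Lemma sum_prod_image (K : comPzRingType) (I S S' : finType) (h : S -> S')
    (mu : I -> S -> K) (G : {ffun I -> S'} -> K) :
  \sum_(f : {ffun I -> S}) (\prod_i mu i (f i)) * G [ffun i => h (f i)] =
  \sum_(g : {ffun I -> S'}) (\prod_i \sum_(s | h s == g i) mu i s) * G g.
Proof.
rewrite (partition_big (fun f : {ffun I -> S} => [ffun i => h (f i)]) xpredT) //.
apply: eq_bigr => g _; rewrite bigA_distr_big_dep big_distrl /=.
apply: eq_big => [f | f /eqP -> //].
apply/eqP/familyP => [<- i | hfg]; first by rewrite ffunE unfold_in.
by apply/ffunP => i; rewrite ffunE; apply/eqP/hfg.
Qed.

(** Hybrid argument: the factors are changed from [x] to [y] one at a time, and the [k]-th term is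
    the cost of the [k]-th change. *)
Lemma ler_norm_prodB (K : realDomainType) (m : nat) (x y : 'I_m -> K) :
    (forall i, 0 <= x i) -> (forall i, 0 <= y i) ->
  `|\prod_i x i - \prod_i y i| <=
  \sum_(k < m) \prod_(i < m)
    (if (i < k)%N then y i else if i == k then `|x i - y i| else x i).
Proof.
elim: m x y => [|m IHm] x y x0 y0; first by rewrite !big_ord0 subrr normr0.
rewrite !big_ord_recl /=.
set X := \prod_i x _; set Y := \prod_i y _.
have X0 : 0 <= X by apply: prodr_ge0.
have -> : x ord0 * X - y ord0 * Y =
  (x ord0 - y ord0) * X + y ord0 * (X - Y) by ring.
apply: le_trans (ler_normD _ _) _; rewrite !normrM (ger0_norm X0).
rewrite (ger0_norm (y0 _)) lerD //.
apply: le_trans (ler_wpM2l (y0 _) (IHm _ _ _ _)) _ => //.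
rewrite mulr_sumr ler_sum // => k _.
by rewrite [leRHS]big_ord_recl.
Qed.

(** In the [k]-th hybrid term every coordinate but [k] sums to 1, which leaves one l1 distance per
    coordinate. *)
Lemma l1_prod (K : realDomainType) (S : finType) (m : nat) (mu nu : S -> K) :
    (forall s, 0 <= mu s) -> (forall s, 0 <= nu s) ->
    \sum_s mu s = 1 -> \sum_s nu s = 1 ->
  \sum_(f : {ffun 'I_m -> S}) `|\prod_i mu (f i) - \prod_i nu (f i)| <=
  m%:R * \sum_s `|mu s - nu s|.
Proof.
move=> mu0 nu0 mu1 nu1.
pose g (k i : 'I_m) s :=
  if (i < k)%N then nu s else if i == k then `|mu s - nu s| else mu s.
have gE k : \sum_(f : {ffun 'I_m -> S}) \prod_i g k i (f i) =
    \sum_s `|mu s - nu s|.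
  rewrite -bigA_distr_bigA (bigD1 k) //= [X in _ * X]big1 ?mulr1 => [|i ik].
    by apply: eq_bigr => s _; rewrite /g ltnn eqxx.
  by rewrite /g (negbTE ik); case: (i < k)%N.
apply: (@le_trans _ _
  (\sum_(f : {ffun 'I_m -> S}) \sum_k \prod_i g k i (f i))).
  by apply: ler_sum => f _; apply: ler_norm_prodB.
rewrite exchange_big /=; under eq_bigr do rewrite gE.
by rewrite sumr_const card_ord mulr_natl.
Qed.

(** Equal total masses force the positive and negative parts of [mu - nu] to have the same sum, so a
    bound from above suffices, at the price of a factor 2. *)
Lemma l1_le (K : realDomainType) (S : finType) (mu nu g : S -> K) :
    \sum_s mu s = 1 -> \sum_s nu s = 1 ->
    (forall s, 0 <= g s) -> (forall s, mu s - nu s <= g s) ->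
  \sum_s `|mu s - nu s| <= 2 * \sum_s g s.
Proof.
move=> mu1 nu1 g0 mug.
have -> : 2 * \sum_s g s = \sum_s (2 * g s - (mu s - nu s)).
  by rewrite !sumrB mu1 nu1 subrr subr0 mulr_sumr.
apply: ler_sum => s _; have g0s := g0 s; have mugs := mug s.
by case: ger0P => _; lra.
Qed.

(** * Random sets with independent elements *)

Section Bernoulli.
Variables (K : realFieldType) (T : finType).
Implicit Types (r : T -> K) (E : {set T}) (p : K).

(** Letting [r] vary with [x] covers G(n, p) as a random set of ordered pairs, with [r] zero outside
    [pairsLt n]. *)
Definition bern r E : K := \prod_x (if x \in E then r x else 1 - r x).

Lemma sum_bern r : \sum_E bern r E = 1.
Proof.
by rewrite /bern -bigA_distr big1 //= => x _; rewrite addrC subrK.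
Qed.

Lemma bern_ge0 r E : (forall x, 0 <= r x <= 1) -> 0 <= bern r E.
Proof.
move=> r01; apply: prodr_ge0 => x _; have /andP[r0 r1] := r01 x.
by case: ifP => // _; rewrite subr_ge0.
Qed.

Lemma bern_mask (D : {set T}) p E :
  bern (fun x => if x \in D then p else 0) E =
  if E \subset D then p ^+ #|E| * (1 - p) ^+ (#|D| - #|E|) else 0.
Proof.
case: ifPn => [ED | /subsetPn[x xE xD]]; last first.
  by rewrite /bern (bigD1 x) //= xE (negbTE xD) mul0r.
rewrite /bern (bigID (mem E)) /=.
congr (_ * _).
  rewrite -prodr_const; apply: eq_bigr => x xE.
  by rewrite xE (subsetP ED).
rewrite (bigID (mem D)) /= [X in _ * X]big1 ?mulr1; last first.
  by move=> x /andP[/negbTE -> /negbTE ->]; rewrite subr0.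
rewrite -[in RHS](setIidPr ED) -cardsD -prodr_const.
apply: eq_big => [x | x /andP[/negbTE -> ->] //].
by rewrite inE.
Qed.

Lemma bern_const p E : bern (fun=> p) E = p ^+ #|E| * (1 - p) ^+ (#|T| - #|E|).
Proof.
transitivity (bern (fun x => if x \in [set: T] then p else 0) E).
  by apply: eq_bigr => x _; rewrite inE.
by rewrite bern_mask subsetT cardsT.
Qed.

Lemma sum_bern_superset r E :
  \sum_(V : {set T} | E \subset V) bern r V = \prod_(x in E) r x.
Proof.
(* The condition [E \subset V] moves into the factors, an omitted element of [E] contributing 0, so
   that the sum distributes over the elements. *)
transitivity (\sum_(V : {set T})
    \prod_x (if x \in V then r x else if x \in E then 0 else 1 - r x)).
  rewrite big_mkcond /=; apply: eq_bigr => V _; case: ifPn => [EV|].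
    apply: eq_bigr => x _; case: ifPn => // xV.
    by case: ifPn => // xE; rewrite (subsetP EV _ xE) in xV.
  by case/subsetPn => x xE xV; rewrite (bigD1 x) //= (negbTE xV) xE mul0r.
rewrite -bigA_distr [RHS]big_mkcond /=; apply: eq_bigr => x _.
by case: ifP => _ /=; rewrite ?addr0 // addrC subrK.
Qed.

(** Union bound over the [k]-subsets: each lies in the random set with probability [p ^+ k], and a
    set with at least [k] elements contains at least one. *)
Lemma sum_bern_card_ge p k : 0 <= p <= 1 ->
  \sum_(V : {set T} | (k <= #|V|)%N) bern (fun=> p) V <=
  'C(#|T|, k)%:R * p ^+ k.
Proof.
move=> p01.
have -> : 'C(#|T|, k)%:R * p ^+ k =
    \sum_(V : {set T}) \sum_(E : {set T} | (#|E| == k) && (E \subset V))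
      bern (fun=> p) V.
  rewrite (exchange_big_dep (fun E : {set T} => #|E| == k)) /=; last first.
    by move=> V E _ /andP[].
  rewrite mulr_natl -card_draws -sumr_const.
  apply: eq_big => [E | E]; rewrite inE // => /eqP Ek.
  under eq_bigl => V do rewrite Ek eqxx.
  by rewrite sum_bern_superset prodr_const Ek.
rewrite [leLHS]big_mkcond; apply: ler_sum => V _.
have b0 : 0 <= bern (fun=> p) V by apply: bern_ge0.
case: ifP => kV; last by apply: sumr_ge0.
rewrite (eq_bigl [in [set E : {set T} | E \subset V & #|E| == k]]); last first.
  by move=> E; rewrite inE andbC.
by rewrite sumr_const cards_draws -mulr_natl ler_peMl // ler1n bin_gt0.
Qed.

End Bernoulli.

(* A random subset of [T * I] seen as independent random subsets of [T]. *)
Lemma sum_bern_slices (K : realFieldType) (T I : finType) (r : T -> K)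
    (G : {set T * I} -> K) :
  \sum_(B : {set T * I}) bern (fun x => r x.1) B * G B =
  \sum_(f : {ffun I -> {set T}}) (\prod_i bern r (f i)) *
     G [set x | x.1 \in f x.2].
Proof.
rewrite (reindex (fun f : {ffun I -> {set T}} => [set x | x.1 \in f x.2])) /=.
  apply: eq_bigr => f _; congr (_ * _).
  rewrite exchange_big pair_big /=.
  by apply: eq_bigr => x _; rewrite inE.
exists (fun B : {set T * I} => [ffun i => [set x | (x, i) \in B]]) => [f|B] _.
  by apply/ffunP => i; apply/setP => x; rewrite ffunE !inE.
by apply/setP => -[x i]; rewrite inE ffunE inE.
Qed.

(** All the sets miss [x] with probability [(1 - r x) ^+ #|I|], independently for distinct [x]. Both
    sides are read off one random subset of [T * I], sliced along [I] and then along [T]. *)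
Lemma sum_bern_bigcup (K : realFieldType) (T I : finType) (r : T -> K)
    (F : {set T} -> K) :
  \sum_(f : {ffun I -> {set T}}) (\prod_i bern r (f i)) * F (\bigcup_i f i) =
  \sum_E bern (fun x => 1 - (1 - r x) ^+ #|I|) E * F E.
Proof.
transitivity (\sum_(B : {set T * I}) bern (fun x => r x.1) B *
    F [set x | [exists i, (x, i) \in B]]).
  rewrite sum_bern_slices; apply: eq_bigr => f _; congr (_ * F _).
  apply/setP => x; rewrite inE.
  apply/bigcupP/existsP => [[i _ xi]|[i]]; first by exists i; rewrite inE.
  by rewrite inE => xi; exists i.
rewrite (reindex (fun g : {ffun T -> {set I}} =>
  [set x | x.2 \in g x.1])) /=; last first.
  exists (fun B : {set T * I} => [ffun x => [set i | (x, i) \in B]]) => [f|B] _.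
    by apply/ffunP => i; apply/setP => x; rewrite ffunE !inE.
  by apply/setP => -[x i]; rewrite inE ffunE inE.
transitivity (\sum_(g : {ffun T -> {set I}})
   (\prod_x bern (fun=> r x) (g x)) *
   F [set x | [ffun x => g x != set0] x]).
  apply: eq_bigr => g _; congr (_ * F _).
    rewrite /bern pair_big /=; apply: eq_bigr => x _.
    by rewrite inE.
  apply/setP => x; rewrite !inE ffunE.
  by apply/existsP/set0Pn => -[i]; [rewrite inE | ]; exists i; rewrite ?inE.
(* The union depends on each row [g x] only through whether it is empty. *)
rewrite (sum_prod_image (fun S : {set I} => S != set0)
   (fun x => bern (fun=> r x)) (fun b => F [set x | b x])).
rewrite [RHS](reindex (fun b : {ffun T -> bool} => [set x | b x])) /=; last first.
  exists (fun E : {set T} => [ffun x => x \in E]) => [b|E] _.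
    by apply/ffunP => x; rewrite ffunE inE.
  by apply/setP => x; rewrite inE ffunE.
apply: eq_bigr => b _; congr (_ * _); apply: eq_bigr => x _.
rewrite inE.
have b0 : bern (fun=> r x) (set0 : {set I}) = (1 - r x) ^+ #|I|.
  by rewrite bern_const cards0 subn0 mul1r.
have := sum_bern (fun _ : I => r x).
rewrite (bigD1 set0) //= b0 => /eqP; rewrite eq_sym addrC -subr_eq => /eqP e.
case: (b x); first by rewrite e; apply: eq_bigl => S; case: (S == set0).
rewrite (big_pred1 set0) ?b0 => [|S]; last by rewrite /=; case: (S == set0).
by rewrite subKr.
Qed.

(** * Cliques spanned by the owners of an object *)

Definition clique (n : nat) (V : {set 'I_n}) : {set 'I_n * 'I_n} :=
  [set e in pairsLt n | (e.1 \in V) && (e.2 \in V)].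

Lemma graph_of_incidence_cliques (n m : nat) (f : {ffun 'I_m -> {set 'I_n}}) :
  graph_of_incidence [set x | x.1 \in f x.2] =
  graph_of_edges (\bigcup_w clique (f w)).
Proof.
have memU i j : ((i, j) \in \bigcup_w clique (f w)) =
    [&& (i < j)%N & [exists w, (i \in f w) && (j \in f w)]].
  apply/bigcupP/andP => [[w _]|[ij /existsP[w ijw]]].
    by rewrite !inE /= => /andP[-> ijw]; split=> //; apply/existsP; exists w.
  by exists w; rewrite // !inE ij.
apply: FunctionalExtensionality.functional_extensionality => i.
apply: FunctionalExtensionality.functional_extensionality => j.
rewrite /graph_of_incidence /graph_of_edges !memU; case: eqVneq => //= ij.
under eq_existsb do rewrite !inE /=.
under [in RHS](@eq_existsb _ (fun w => (j \in f w) && (i \in f w)))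
  do rewrite andbC.
case: ltngtP => [_|//|/val_inj ijE] /=; first by rewrite orbF.
by rewrite ijE eqxx in ij.
Qed.

(** Makes the probability of a single edge exactly [q]: its two endpoints own the object and no
    other vertex does. *)
Lemma clique_pair (n : nat) (e : 'I_n * 'I_n) (V : {set 'I_n}) :
  e \in pairsLt n -> (clique V == [set e]) = (V == [set e.1; e.2]).
Proof.
case: e => i j; rewrite inE /= => ij.
apply/eqP/eqP => [VE | ->]; last first.
  apply/setP => -[k l]; rewrite !inE /= xpair_eqE.
  case: (k =P i) => [->|_] /=; case: (l =P j) => [->|_] /=.
  - by rewrite ij orbT.
  - by case: (l =P i) => [->|_]; rewrite ?ltnn ?andbF.
  - by case: (k =P j) => [->|_]; rewrite ?ltnn ?andbF.
  - case: (k =P j) => [->|_] /=; rewrite ?andbF //.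
    by case: (l =P i) => [->|_]; rewrite ?andbF // ltnNge ltnW.
(* Any two members of [V], in increasing order, form the edge [(i, j)]; a third member paired with
   [i] would form another one. *)
have cliqueE (k l : 'I_n) : (k < l)%N -> k \in V -> l \in V -> (k == i) && (l == j).
  move=> kl kV lV; rewrite -xpair_eqE -in_set1 -VE !inE /=.
  by rewrite kl kV.
have /andP[iV jV] : (i \in V) && (j \in V).
  have : (i, j) \in clique V by rewrite VE inE.
  by rewrite !inE => /andP[].
apply/setP => k; rewrite !inE; apply/idP/idP => [kV|/orP[/eqP->|/eqP->] //].
case: (ltngtP k i) => [ki|ik|/val_inj ->]; last by rewrite eqxx.
  by have /andP[->] := cliqueE _ _ ki kV iV.
by have /andP[_ ->] := cliqueE _ _ ik iV kV; rewrite orbT.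
Qed.

(** * The l1 distance between the laws of one copy *)

Lemma bernoulli_ineq (K : realFieldType) (r : K) k :
  0 <= r <= 1 -> 1 - k%:R * r <= (1 - r) ^+ k.
Proof.
move=> /andP[r0 r1]; elim: k => [|k IHk]; first by rewrite mul0r subr0.
rewrite exprS; apply: le_trans (ler_wpM2l _ IHk); last by rewrite subr_ge0.
rewrite -natr1; have k0 : 0 <= k%:R * (r * r) by rewrite !mulr_ge0.
by rewrite mulrBl mul1r mulrBr mulr1 mulrCA; lra.
Qed.

Section CliqueLaw.
Variables (K : realFieldType) (n : nat) (p : K).
Hypothesis p01 : 0 <= p <= 1.
Let D := pairsLt n.
Let q : K := p ^+ 2 * (1 - p) ^+ (n - 2).
Let pairs : {set {set 'I_n * 'I_n}} := [set [set e] | e in D].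

(* The law of the clique spanned by the owners of one object. *)
Definition clique_law (E : {set 'I_n * 'I_n}) : K :=
  \sum_(V : {set 'I_n} | clique V == E) bern (fun=> p) V.

Lemma clique_law_ge0 E : 0 <= clique_law E.
Proof. by apply: sumr_ge0 => V _; apply: bern_ge0. Qed.

Lemma sum_clique_law : \sum_E clique_law E = 1.
Proof. by rewrite sum_preim sum_bern. Qed.

Lemma clique_law_pair e : e \in D -> clique_law [set e] = q.
Proof.
move=> eD; rewrite /clique_law (eq_bigl _ _ (fun V => clique_pair V eD)).
rewrite big_pred1_eq bern_const card_ord cards2.
by move: eD; rewrite inE ltn_neqAle => /andP[/negbTE e12 _]; rewrite -val_eqE e12.
Qed.

Lemma sum_pairs (F : {set 'I_n * 'I_n} -> K) (c : K) :
  (forall e, e \in D -> F [set e] = c) ->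
  \sum_(E in pairs) F E = #|D|%:R * c.
Proof.
move=> Fc; rewrite big_imset /=; last by move=> x y _ _; apply: set1_inj.
by rewrite (eq_bigr _ Fc) sumr_const mulr_natl.
Qed.

Lemma set0_pairs : set0 \notin pairs.
Proof. by apply/imsetP => -[e _ /setP/(_ e)]; rewrite !inE eqxx. Qed.

Lemma sum_split_pairs (F : {set 'I_n * 'I_n} -> K) :
  \sum_E F E = F set0 + (\sum_(E in pairs) F E +
    \sum_(E | (E != set0) && (E \notin pairs)) F E).
Proof.
rewrite (bigD1 set0) //= (bigID (mem pairs)) /=; congr (_ + (_ + _)).
apply: eq_bigl => E; case: eqP => //= ->.
by rewrite (negbTE set0_pairs).
Qed.

Lemma clique_law_set0_le : clique_law set0 <= 1 - #|D|%:R * q.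
Proof.
have := sum_clique_law; rewrite sum_split_pairs (sum_pairs clique_law_pair).
rewrite addrA lerBrDr => mu1; rewrite -[leRHS]mu1.
by rewrite lerDl sumr_ge0 // => E _; exact: clique_law_ge0.
Qed.

(** A nonempty clique that is not a single edge has at least three owners. *)
Lemma clique_law_rest_le :
  \sum_(E | (E != set0) && (E \notin pairs)) clique_law E <= 'C(n, 3)%:R * p ^+ 3.
Proof.
rewrite sum_preim -[n in 'C(n, _)]card_ord.
apply: le_trans (sum_bern_card_ge _ _ p01).
rewrite big_mkcond [leRHS]big_mkcond; apply: ler_sum => V _.
have b0 : 0 <= bern (fun=> p) V by apply: bern_ge0.
case: ifP => [/andP[/set0Pn[e eV] cV]|_]; last by case: ifP.
rewrite ifT // ltnNge; apply: contra cV => V2.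
have eD : e \in D by move: eV; rewrite inE => /andP[].
apply/imsetP; exists e => //; apply/eqP; rewrite clique_pair // eq_sym eqEcard.
rewrite cards2 subUset !sub1set; move: eV; rewrite inE => /andP[_ ->] /=.
apply: leq_trans V2 _; move: eD.
by rewrite inE ltn_neqAle -val_eqE => /andP[->].
Qed.

(** Only the excess of the clique law over the Bernoulli law needs a bound [g]: zero at the empty
    set, [#|D| q^2] at each of the [#|D|] single edges, and the clique law itself elsewhere. *)
Lemma clique_law_l1 (r : K) : 0 <= r -> q - q ^+ 2 <= r -> r <= q ->
  \sum_E `|clique_law E - bern (fun e => if e \in D then r else 0) E| <=
  2 * ((#|D|%:R * q) ^+ 2 + 'C(n, 3)%:R * p ^+ 3).
Proof.
move=> r0 qr rq; have /andP[p0 p1] := p01.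
have q1 : q <= 1.
  by rewrite mulr_ile1 ?exprn_ge0 ?exprn_ile1 ?subr_ge0 // gerBl.
have r01 : 0 <= r <= 1 by rewrite r0 (le_trans rq).
pose g E := if E == set0 then 0 else
  if E \in pairs then q * (#|D|%:R * q) else clique_law E.
apply: (@le_trans _ _ (2 * \sum_E g E)); last first.
  rewrite ler_pM2l ?ltr0n // sum_split_pairs {1}/g eqxx add0r.
  apply: lerD.
    rewrite (sum_pairs (c := q * (#|D|%:R * q))) => [|e eD].
      by rewrite [leRHS]expr2 -!mulrA.
    rewrite /g imset_f //.
    by have /negbTE -> : [set e] != set0 by apply/set0Pn; exists e; rewrite inE.
  apply: le_trans clique_law_rest_le.
  by apply: ler_sum => E /andP[/negbTE E0 /negbTE Ep]; rewrite /g E0 Ep.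
have q0 : 0 <= q by rewrite mulr_ge0 ?exprn_ge0 // subr_ge0.
have nu_ge0 E : 0 <= bern (fun e => if e \in D then r else 0) E.
  by apply: bern_ge0 => e; case: ifP; rewrite ?lexx ?ler01.
apply: l1_le; [exact: sum_clique_law | exact: sum_bern | move=> E | move=> E].
  rewrite /g; case: ifP => // _; case: ifP => _; last exact: clique_law_ge0.
  by apply: mulr_ge0 => //; apply: mulr_ge0.
(* Empty set: [1 - #|D| q <= 1 - #|D| r <= (1 - r)^#|D|], so there is no excess. *)
rewrite /g; case: eqP => [-> | _].
  rewrite bern_mask sub0set cards0 subn0 mul1r subr_le0.
  apply: le_trans clique_law_set0_le _; apply: le_trans (bernoulli_ineq _ r01).
  by rewrite lerD2l lerN2 ler_wpM2l.
case: ifP => [/imsetP[e eD ->]|_]; last by rewrite gerBl.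
rewrite clique_law_pair // bern_mask sub1set eD cards1 expr1.
have [k ->] : exists k, #|D| = k.+1.
  by exists #|D|.-1; rewrite prednK //; apply/card_gt0P; exists e.
(* Single edge: [r (1 - r)^k >= r - k r^2 >= q - q^2 - k q^2], with [k + 1 = #|D|]. *)
have k0 : 0 <= k%:R * (q * q - r * r) by rewrite mulr_ge0 ?subr_ge0 ?ler_pM.
have := ler_wpM2l r0 (bernoulli_ineq k r01).
rewrite subn1 /= -natr1; move: qr k0; move: q (_ ^+ k) => x s; lra.
Qed.

End CliqueLaw.

(** * Distance between the two graph models *)

Lemma prob_GnpE (n : nat) (p : R) (A : graph_property) :
  prob_Gnp n p A = \sum_E bern (fun e => if e \in pairsLt n then p else 0) E *
    (A n (graph_of_edges E))%:R.
Proof.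
apply: eq_bigr => E _; rewrite bern_mask.
case: (E \subset _); rewrite /= ?mul0r //.
by case: (A n _); rewrite ?mulr1 ?mulr0 // !RpowE.
Qed.

Lemma prob_RIGE (n m : nat) (p : R) (A : graph_property) :
  prob_RIG n m p A =
  \sum_(h : {ffun 'I_m -> {set 'I_n * 'I_n}}) (\prod_w clique_law p (h w)) *
    (A n (graph_of_edges (\bigcup_w h w)))%:R.
Proof.
transitivity (\sum_(B : {set 'I_n * 'I_m}) bern (fun=> p) B *
    (A n (graph_of_incidence B))%:R).
  apply: eq_bigr => B _; rewrite bern_const card_prod !card_ord.
  by case: (A n _); rewrite ?mulr1 ?mulr0 // !RpowE.
rewrite (sum_bern_slices (fun=> p)).
rewrite -(sum_prod_image (@clique n) (fun _ => bern (fun=> p))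
  (fun h => (A n (graph_of_edges (\bigcup_w h w)))%:R)).
apply: eq_bigr => f _; rewrite graph_of_incidence_cliques.
by congr (_ * (A n (graph_of_edges _))%:R); apply: eq_bigr => w _; rewrite ffunE.
Qed.

Lemma expN_bounds (q : R) : 0 <= q <= 1 -> q - q ^+ 2 <= 1 - exp (- q) <= q.
Proof.
move=> /andP[q0 q1].
have e1 : 1 - q <= exp (- q) by apply/RleP; exact: exp_ineq1_le.
have e2 : (1 + q) * exp (- q) <= 1.
  have eE : exp q * exp (- q) = 1 by rewrite expRD RplusE RoppE subrr exp_0.
  rewrite -[leRHS]eE.
  apply: ler_wpM2r; first by apply/ltW/RltP; exact: exp_pos.
  by apply/RleP; exact: exp_ineq1_le.
(* It follows from [exp (- q) <= 1 / (1 + q)] and [(1 + q) (1 - q + q^2) = 1 + q^3 >= 1]. *)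
suff e3 : exp (- q) <= 1 - q + q ^+ 2 by apply/andP; split; lra.
rewrite -(@ler_pM2l _ (1 + q)); last by rewrite ltr_pwDl.
apply: le_trans e2 _; have q3 : 0 <= q ^+ 3 by rewrite exprn_ge0.
lra.
Qed.

Lemma prob_dist (n m : nat) (p : R) (A : graph_property) : 0 <= p <= 1 ->
  `|prob_RIG n m p A - prob_Gnp n (phat n m p) A| <=
  2 * (m%:R * (n%:R * p) ^+ 4 + m%:R * (n%:R * p) ^+ 3).
Proof.
move=> p01; have /andP[p0 p1] := p01.
have s0 : 0 <= 1 - p by rewrite subr_ge0.
pose q : R := p ^+ 2 * (1 - p) ^+ (n - 2).
have q0 : 0 <= q by rewrite mulr_ge0 ?exprn_ge0.
have qp : q <= p ^+ 2.
  by rewrite ler_piMr ?exprn_ge0 ?exprn_ile1 // gerBl.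
have q1 : q <= 1 by rewrite (le_trans qp) // exprn_ile1.
pose r := 1 - exp (- q).
have /andP[qr rq] : q - q ^+ 2 <= r <= q by apply: expN_bounds; rewrite q0.
have r0 : 0 <= r by rewrite (le_trans _ qr) // subr_ge0 expr2 ler_piMr.
pose nu := bern (fun e => if e \in pairsLt n then r else 0).
have phatE : phat n m p = 1 - (1 - r) ^+ m.
  rewrite /phat subKr expRX !RpowE INRE; congr (1 - exp _).
  by rewrite mulNrn RoppE !RmultE -mulrA mulr_natl.
have nu_ge0 E : 0 <= nu E.
  apply: bern_ge0 => e; case: ifP; rewrite ?lexx ?ler01 // => _.
  by rewrite r0 (le_trans rq).
have -> : prob_Gnp n (phat n m p) A =
    \sum_(h : {ffun 'I_m -> {set 'I_n * 'I_n}}) (\prod_w nu (h w)) *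
      (A n (graph_of_edges (\bigcup_w h w)))%:R.
  rewrite (sum_bern_bigcup _ _ (fun E => (A n (graph_of_edges E))%:R)) prob_GnpE.
  apply: eq_bigr => E _; congr (_ * _); apply: eq_bigr => e _.
  rewrite card_ord phatE.
  by case: (e \in pairsLt n); rewrite ?subr0 ?expr1n ?subrr ?subr0.
rewrite prob_RIGE -sumrB.
apply: le_trans (ler_norm_sum _ _ _) _.
(* Dropping the indicator of [A], which is at most 1, leaves the l1 distance of the product laws. *)
apply: (@le_trans _ _ (\sum_(h : {ffun 'I_m -> {set 'I_n * 'I_n}})
    `|\prod_w clique_law p (h w) - \prod_w nu (h w)|)).
  apply: ler_sum => h _; rewrite -mulrBl normrM ler_piMr //.
  by case: (A n _); rewrite ?normr1 ?normr0 ?ler01.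
apply: le_trans (l1_prod _ _ _ _ _) _ => //.
- by move=> E; apply: clique_law_ge0.
- exact: sum_clique_law.
- exact: sum_bern.
rewrite -mulrDr mulrCA; apply: ler_wpM2l => //.
apply: le_trans (clique_law_l1 p01 r0 qr rq) _.
(* The binomial coefficient is at most [n^3]; [#|D| <= n^2] and [q <= p^2] give
   [#|D| q <= (n p)^2]. *)
rewrite ler_pM2l ?ltr0n //; apply: lerD; last first.
  rewrite exprMn ler_wpM2r ?exprn_ge0 // -natrX ler_nat.
  apply: leq_trans (_ : n ^_ 3 <= _)%N; first by rewrite -bin_ffact leq_pmulr.
  by rewrite !ffactnSr !expnSr !leq_mul ?leq_subr.
rewrite [_ ^+ 4](exprM _ 2 2) ler_sqr ?nnegrE ?mulr_ge0 ?exprn_ge0 //.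
rewrite exprMn ler_pM // -natrX ler_nat (leq_trans (max_card _)) //.
by rewrite card_prod card_ord.
Qed.

(** * Passage to the limit *)

Lemma Un_cv_dist (u v : nat -> R) (a : R) :
  Un_cv (fun n => u n - v n) 0 -> Un_cv v a <-> Un_cv u a.
Proof.
move=> uv; split=> [va | ua].
  have := CV_plus _ _ _ _ uv va; rewrite RplusE add0r.
  by apply: Un_cv_ext => n; rewrite RplusE subrK.
have := CV_minus _ _ _ _ ua uv; rewrite RminusE subr0.
by apply: Un_cv_ext => n; rewrite RminusE subKr.
Qed.

Lemma prob_dist_cv (m : nat -> nat) (p : nat -> R) (A : graph_property) :
  (forall n, (0 < m n)%N) -> (forall n, Rle R0 (p n) /\ Rle (p n) R1) ->
  Un_cv (fun n => Rmult (Rmult (p n) (INR n))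
    (Rpower (INR (m n)) (Rdiv R1 (INR 3)))) R0 ->
  Un_cv (fun n => prob_RIG n (m n) (p n) A -
    prob_Gnp n (phat n (m n) (p n)) A) 0.
Proof.
move=> m0 p01 x_cv eps /RltP eps0.
(* For [x = n p m^(1/3)] below 1, both [x^3] and [x^4] are at most [x], so the distance is at most
   [2 (x + x)]; hence [eps / 4]. *)
have d0 : 0 < Num.min 1 (eps / 4) :> R by rewrite lt_min ltr01 divr_gt0 ?ltr0n.
have [N xN] := x_cv _ (elimT RltP d0).
exists N => n /xN; rewrite !RdistE !subr0 => /RltP; rewrite lt_min.
have {}p01 : 0 <= p n <= 1 by have [/RleP -> /RleP ->] := p01 n.
have /andP[p0 p1] := p01.
set c := Rpower _ _; rewrite !RmultE !INRE.
have mc : (m n)%:R = c ^+ 3.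
  rewrite -RpowE -Rpower_pow; last exact: exp_pos.
  rewrite Rpower_mult /Rdiv Rmult_assoc Rinv_l; last by apply: not_0_INR.
  by rewrite !Rmult_1_l Rpower_1 ?INRE //; apply/RltP; rewrite ltr0n.
have c0 : 0 < c by apply/RltP; apply: exp_pos.
have c1 : 1 <= c.
  by rewrite -(@ler_pXn2r _ 3) ?nnegrE ?(ltW c0) // expr1n -mc ler1n.
have np0 : 0 <= n%:R * p n by rewrite mulr_ge0.
set x := _ * c.
have x0 : 0 <= x by rewrite !mulr_ge0 ?(ltW c0).
rewrite ger0_norm // => /andP[x1 xeps]; apply/RltP.
apply: le_lt_trans (prob_dist _ _ _ p01) _; rewrite mc.
have -> : c ^+ 3 * (n%:R * p n) ^+ 3 = x ^+ 3 by rewrite /x; ring.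
(* The left side lacks one factor [c] of [x^4], and [c >= 1] because [m n >= 1]. *)
have h4 : c ^+ 3 * (n%:R * p n) ^+ 4 <= x ^+ 4.
  have -> : x ^+ 4 = c * (c ^+ 3 * (n%:R * p n) ^+ 4) by rewrite /x; ring.
  by rewrite ler_peMl // mulr_ge0 ?exprn_ge0 ?(ltW c0).
have x3 : x ^+ 3 <= x by rewrite ler_iXnr ?(ltW x1).
have x4 : x ^+ 4 <= x by rewrite ler_iXnr ?(ltW x1).
lra.
Qed.

Theorem theorem1 (m : nat -> nat) (p : nat -> R) (a : R) (A : graph_property) :
  (forall n, (0 < m n)%N) ->
  (forall n, Rle R0 (p n) /\ Rle (p n) R1) ->
  Un_cv (fun n => Rmult (Rmult (p n) (INR n)) (Rpower (INR (m n)) (Rdiv R1 (INR 3)))) R0 ->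
  Rle R0 a /\ Rle a R1 ->
  iso_closed A ->
  (Un_cv (fun n => prob_Gnp n (phat n (m n) (p n)) A) a <->
   Un_cv (fun n => prob_RIG n (m n) (p n) A) a).
Proof.
by move=> m0 p01 x_cv _ _; apply/Un_cv_dist/prob_dist_cv.
Qed.
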